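(* Let $S=\{\rho_1,\dots,\rho_n\}$ be a known set of $n$ quantum states, all of which are pure, $\rho_i=|\psi_i\rangle\langle\psi_i|$ with unit vectors $|\psi_i\rangle$. Let $G$ be the $n\times n$ Gram matrix $G_{ij}=\langle\psi_i|\psi_j\rangle$, with operator norm $\|G\|$. Then the worst-case state discrimination problem for $S$ can be solved with success probability at least $\|G\|^{-1}$ by applying the pretty good measurement of $\rho_1,\dots,\rho_n$ to one copy of the unknown state $\rho$. If additionally, for some $\epsilon>0$, $\operatorname{tr}(\rho_i\rho_j)\le 1-\epsilon$ for all pairs of distinct states $\rho_i,\rho_j$ in $S$, then there is an explicit measurement strategy which, applied to $$O\big((\|G\|/\epsilon)\,(\log 1/\delta)\,\log(\|G\|/\delta)\big)=\widetilde O(\|G\|/\epsilon)$$ copies of $\rho$, solves the worst-case state discrimination problem with failure probability $\delta$.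
   Context: Worst-case state discrimination problem: one is given one or more copies of an unknown state $\rho$ picked from the known set $S=\{\rho_1,\dots,\rho_n\}$, and must identify which $\rho_i$ it is. A measurement on $k$ copies is a POVM on $\rho^{\otimes k}$, i.e. a family of positive semidefinite operators $\mu_i$ with $\sum_i\mu_i=I$; outcome $i$ occurs on input $\rho_j^{\otimes k}$ with probability $\operatorname{tr}(\mu_i\rho_j^{\otimes k})$. The failure probability is the worst-case one, $\max_i\,(1-\operatorname{tr}(\mu_i\rho_i^{\otimes k}))$, and the success probability is one minus this, i.e. $\min_i\operatorname{tr}(\mu_i\rho_i^{\otimes k})$. The target failure probability $\delta>0$ is given in advance. The pretty good measurement (PGM) of $\rho_1,\dots,\rho_n$ has measurement operators $\mu_i=\Sigma^{-1/2}\rho_i\Sigma^{-1/2}$, where $\Sigma=\sum_i\rho_i$ and the inverse is taken on the support of $\Sigma$; these operators sum to the identity on that support. No prior probabilities are used. ''Explicit'' is used informally: the measurement strategy can be described concretely, as opposed to being shown to exist by a nonconstructive argument. $\widetilde O(f(\|G\|,\epsilon,\delta))$ denotes $O\big(f(\|G\|,\epsilon,\delta)\,\operatorname{polylog}(\|G\|,1/\epsilon,1/\delta)\big)$. *)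

(* Defs.v *)
From mathcomp Require Export all_boot all_order all_algebra.
From mathcomp Require Export all_classical all_reals all_analysis.
From mathcomp.real_closed Require Export complex.
(* Not imported: its notation "A ^t k" clashes with "A ^t phi". *)
From mathcomp.real_closed Require mxtens.

Set Implicit Arguments.
Unset Strict Implicit.
Unset Printing Implicit Defensive.

Import Order.TTheory GRing.Theory Num.Theory.
Local Open Scope complex_scope.
Local Open Scope ring_scope.
Local Open Scope sesquilinear_scope.

Section Discrimination.
Variable R : realType.
Local Notation C := (R[i]).

Definition dotc d (u v : 'cV[C]_d) : C := (u ^t* *m v) 0 0.

Definition l2norm d (v : 'cV[C]_d) : R := Num.sqrt (complex.Re (dotc v v)).

Definition opnorm m n (A : 'M[C]_(m, n)) : R :=
  sup [set l2norm (A *m x) | x in [set x : 'cV[C]_n | l2norm x <= 1]]%classic.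

(* Over C, [0 <= z] forces z to be real, so this implies that A is Hermitian. *)
Definition psdmx d (A : 'M[C]_d) : Prop := forall v : 'cV[C]_d, 0 <= dotc v (A *m v).

Definition is_POVM (I : finType) d (mu : I -> 'M[C]_d) : Prop :=
  (forall i, psdmx (mu i)) /\ \sum_i mu i = 1%:M.

Definition proj1 d (psi : 'cV[C]_d) : 'M[C]_d := psi *m psi ^t*.

(* A set of n pure states, enumerated without repetition.  Vectors equal up to
   a phase are the same state, hence injectivity on projectors. *)
Definition pure_state_set d n (psi : 'I_n -> 'cV[C]_d) : Prop :=
  (forall i, l2norm (psi i) = 1) /\ injective (fun i => proj1 (psi i)).

Definition gram d n (psi : 'I_n -> 'cV[C]_d) : 'M[C]_n :=
  \matrix_(i, j) dotc (psi i) (psi j).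

Definition tpow d (A : 'M[C]_d) (k : nat) : 'M[C]_(d ^ k) := mxtens.ntensmx A k.

Definition tensc d k l (A : 'M[C]_(d ^ k)) (B : 'M[C]_(d ^ l)) :
    'M[C]_(d ^ (k + l)) :=
  castmx (esym (expnD d k l), esym (expnD d k l)) (mxtens.tensmx A B).

(* The maximum is taken over {0} and the n failure probabilities; the latter
   are nonnegative for a measurement, so 0 only matters when n = 0. *)
Definition failure_prob d n k (mu : 'I_n -> 'M[C]_(d ^ k))
    (rho : 'I_n -> 'M[C]_d) : R :=
  \big[Num.max/0]_(i < n) (1 - complex.Re (\tr (mu i *m tpow (rho i) k))).

Definition success_prob d n k (mu : 'I_n -> 'M[C]_(d ^ k))
    (rho : 'I_n -> 'M[C]_d) : R := 1 - failure_prob mu rho.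

(* A^(-1/2) on the support of A, for A positive semidefinite:
   A = P^-1 diag(D) P with P unitary, and zero eigenvalues stay zero because
   0^-1 = 0. *)
Definition invsqrtmx d (A : 'M[C]_d) : 'M[C]_d :=
  invmx (spectralmx A)
    *m diag_mx (map_mx (fun x => (sqrtC x)^-1) (spectral_diag A))
    *m spectralmx A.

Definition pgm d n (rho : 'I_n -> 'M[C]_d) (i : 'I_n) : 'M[C]_d :=
  let S := invsqrtmx (\sum_j rho j) in S *m rho i *m S.

(* The operators of the pretty good measurement sum to the projector onto the
   support of \sum_j rho j; outcome None stands for its complement. *)
Definition complete_meas d n (mu : 'I_n -> 'M[C]_d) (o : option 'I_n) : 'M[C]_d :=
  if o is Some i then mu i else 1%:M - \sum_j mu j.

(* One round acts on 1 + m fresh copies: apply the pretty good measurement to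
   the first copy, and if it yields i, check with the projective measurement
   {rho i, 1 - rho i} that each of the m other copies is in state i.
   [accept rho m i] is the effect "i is obtained and passes all m checks". *)
Definition accept d n (rho : 'I_n -> 'M[C]_d) (m : nat) (i : 'I_n) :
    'M[C]_(d ^ (1 + m)) :=
  @tensc d 1 m (pgm rho i) (tpow (rho i) m).

(* At most r rounds: output the first accepted i; if no round accepts, output
   the first state. *)
Fixpoint repeat_rounds d n (rho : 'I_n.+1 -> 'M[C]_d) (m r : nat) (i : 'I_n.+1) :
    'M[C]_(d ^ (r * (1 + m))) :=
  if r is r'.+1 return 'M[C]_(d ^ (r * (1 + m))) then
    @tensc d (1 + m) (r' * (1 + m)) (accept rho m i) 1%:M
    + @tensc d (1 + m) (r' * (1 + m)) (1%:M - \sum_j accept rho m j)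
        (repeat_rounds rho m r' i)
  else (i == ord0)%:R%:M.

(* Here N is the norm of the Gram matrix.  Two distinct states satisfy the
   separation hypothesis only if eps <= 1, so eps > 1 forces a singleton set
   and no copy is needed. *)
Definition rounds (N eps delta : R) : nat :=
  if 1 < eps then 0 else (Num.truncn (N * ln (2 / delta))).+1.

Definition checks (N eps delta : R) : nat :=
  (Num.truncn (ln (2 * (rounds N eps delta)%:R / delta) / eps)).+1.

Definition copies (N eps delta : R) : nat :=
  (rounds N eps delta * (1 + checks N eps delta))%N.

Definition strategy d n (psi : 'I_n.+1 -> 'cV[C]_d) (eps delta : R) :
    'I_n.+1 -> 'M[C]_(d ^ copies (opnorm (gram psi)) eps delta) :=
  let N := opnorm (gram psi) in
  @repeat_rounds d n (fun i => proj1 (psi i))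
    (checks N eps delta) (rounds N eps delta).

(* Uniform in N >= 1, eps > 0 and delta in ]0, delta0], for every delta0 < 1:
   since log (1 / delta) vanishes at delta = 1, bounds featuring it are only
   meaningful for delta bounded away from 1. *)
Definition bigO3 (f g : R -> R -> R -> R) : Prop :=
  forall delta0 : R, 0 < delta0 < 1 ->
  exists2 K : R, 0 < K & forall N eps delta : R,
    1 <= N -> 0 < eps -> 0 < delta <= delta0 ->
    `|f N eps delta| <= K * `|g N eps delta|.

(* f = O(g polylog(N, 1/eps, 1/delta)). *)
Definition softO3 (f g : R -> R -> R -> R) : Prop :=
  exists p : nat, bigO3 f (fun N eps delta =>
    g N eps delta * (1 + `|ln N| + `|ln eps^-1| + `|ln delta^-1|) ^+ p).

End Discrimination.

(* Main.v *)
(* On one copy: with S = sum_i |psi_i><psi_i|, the pretty good measurement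
   succeeds on psi_i with probability <psi_i|S^(-1/2)|psi_i>^2.  The nonzero
   eigenvalues of S are eigenvalues of the Gram matrix G, so they are at most
   ||G||, and psi_i lies in the support of S; hence the inner product is at
   least ||G||^(-1/2).

   Rounds: on input psi_i, a round accepts i with probability at least 1/||G||
   and accepts some j <> i with probability at most (1 - eps)^m.  With q the
   probability that nothing is accepted, the failure probability satisfies
   f_(r+1) <= (1 - eps)^m + q f_r with q <= 1 - 1/||G||, so that
   f_r <= r (1 - eps)^m + (1 - 1/||G||)^r, and each term is at most delta/2. *)
From mathcomp Require Import ring lra.
Require Import Defs.
Import Order.TTheory GRing.Theory Num.Theory.
Local Open Scope ring_scope.

Set Implicit Arguments.
Unset Strict Implicit.
Unset Printing Implicit Defensive.
Local Open Scope complex_scope.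
Local Open Scope sesquilinear_scope.

(** * Factorized positive semidefinite matrices, projectors and quadratic forms *)

Section Gramian.
Variable C : numClosedFieldType.

Lemma adjmxM m n p (A : 'M[C]_(m, n)) (B : 'M[C]_(n, p)) :
  (A *m B) ^t* = B ^t* *m A ^t*.
Proof. by rewrite trmx_mul map_mxM. Qed.

Lemma adjmxB m n (A B : 'M[C]_(m, n)) : (A - B) ^t* = A ^t* - B ^t*.
Proof. by rewrite linearB map_mxB. Qed.

Lemma adjmx1 n : (1%:M : 'M[C]_n) ^t* = 1%:M.
Proof. by rewrite trmx1 map_mx1. Qed.

(* Positive semidefiniteness in factorized form, for which stability under
   sums and tensor products needs no spectral theory. *)
Definition gramian n (A : 'M[C]_n) :=
  exists m (B : 'M[C]_(m, n)), A = B ^t* *m B.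

Lemma mxtrace_adj_mul_ge0 m n (A : 'M[C]_(m, n)) : 0 <= \tr (A ^t* *m A).
Proof.
rewrite sumr_ge0 // => i _; rewrite mxE sumr_ge0 // => j _.
by rewrite !mxE mulrC; exact: mul_conjC_ge0.
Qed.

Lemma gramian_ge0 n (A : 'M[C]_n) (v : 'cV[C]_n) :
  gramian A -> 0 <= (v ^t* *m (A *m v)) 0 0.
Proof.
case=> m [B ->]; rewrite -mulmxA mulmxA -adjmxM -trace_mx11.
exact: mxtrace_adj_mul_ge0.
Qed.

Lemma gramian1 n : gramian (1%:M : 'M[C]_n).
Proof. by exists n, 1%:M; rewrite adjmx1 mulmx1. Qed.

Lemma gramian0 n : gramian (0 : 'M[C]_n).
Proof. by exists n, 0; rewrite mulmx0. Qed.

Lemma gramianD n (A B : 'M[C]_n) : gramian A -> gramian B -> gramian (A + B).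
Proof.
case=> p [X ->] [q [Y ->]]; exists (p + q)%N, (col_mx X Y).
by rewrite tr_col_mx map_row_mx mul_row_col.
Qed.

Lemma gramian_sum n (I : finType) (F : I -> 'M[C]_n) :
  (forall i, gramian (F i)) -> gramian (\sum_i F i).
Proof. by move=> gF; apply: big_ind => //; [exact: gramian0|exact: gramianD]. Qed.

Lemma gramian_cast n n' (e : n = n') (A : 'M[C]_n) :
  gramian A -> gramian (castmx (e, e) A).
Proof. by case: _ / e => //; rewrite castmx_id. Qed.

Lemma gramian_tens m n (A : 'M[C]_m) (B : 'M[C]_n) :
  gramian A -> gramian B -> gramian (mxtens.tensmx A B).
Proof.
case=> p [X ->] [q [Y ->]]; exists (p * q)%N, (mxtens.tensmx X Y).
by rewrite mxtens.trmx_tens mxtens.map_mxT mxtens.tensmx_mul.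
Qed.

(** With [A = X ^t* X] and [B = Y ^t* Y], cyclicity turns the trace into that of [Z ^t* Z] for
    [Z = X Y ^t*]. *)
Lemma gramian_mxtrace_ge0 d (A B : 'M[C]_d) :
  gramian A -> gramian B -> 0 <= \tr (A *m B).
Proof.
case=> p [X ->] [q [Y ->]].
rewrite mulmxA mxtrace_mulC !mulmxA -(mulmxA (Y *m _)).
rewrite -[Y in X in 0 <= \tr (X *m _)]trmxCK -adjmxM.
exact: mxtrace_adj_mul_ge0.
Qed.

Definition projector n (A : 'M[C]_n) := A ^t* = A /\ A *m A = A.

Lemma projector_gramian n (A : 'M[C]_n) : projector A -> gramian A.
Proof. by case=> hA iA; exists n, A; rewrite hA iA. Qed.

Lemma projectorC n (A : 'M[C]_n) : projector A -> projector (1%:M - A).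
Proof.
case=> hA iA; split; first by rewrite adjmxB adjmx1 hA.
by rewrite mulmxBl mul1mx mulmxBr mulmx1 iA subrr subr0.
Qed.

Lemma projector_ntens d (A : 'M[C]_d) k :
  projector A -> projector (mxtens.ntensmx A k).
Proof.
move=> [hA iA]; case: k => [|k].
  by split; [exact: adjmx1|exact: mulmx1].
elim: k => [//|k [hAk iAk]]; split; last by rewrite mxtens.tensmx_mul iA iAk.
by rewrite mxtens.trmx_tens mxtens.map_mxT hA hAk.
Qed.

Lemma projector_proj1 d (v : 'cV[C]_d) :
  (v ^t* *m v) 0 0 = 1 -> projector (v *m v ^t*).
Proof.
move=> v1; split; first by rewrite adjmxM trmxCK.
rewrite mulmxA -(mulmxA v) [v ^t* *m v]mx11_scalar v1.
by rewrite mulmx1.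
Qed.

Lemma mxtrace_mul_proj1 d (A : 'M[C]_d) (v : 'cV[C]_d) :
  \tr (A *m (v *m v ^t*)) = (v ^t* *m (A *m v)) 0 0.
Proof. by rewrite mulmxA mxtrace_mulC trace_mx11. Qed.

Lemma adj_mul_diag n (v : 'cV[C]_n) (D : 'rV[C]_n) :
  (v ^t* *m diag_mx D *m v) 0 0 = \sum_k `|v k 0| ^+ 2 * D 0 k.
Proof.
rewrite mul_mx_diag mxE; apply: eq_bigr => k _.
by rewrite normCK !mxE; ring.
Qed.

Lemma adj_mul n (v : 'cV[C]_n) : (v ^t* *m v) 0 0 = \sum_k `|v k 0| ^+ 2.
Proof. by rewrite mxE; apply: eq_bigr => k _; rewrite normCK !mxE mulrC. Qed.

End Gramian.

(** * Spectral calculus of [S = X X ^t*]; the columns of [X] will be the state vectors *)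

Section Spectral.
Variables (C : numClosedFieldType) (d n : nat) (X : 'M[C]_(d, n)).
Let S := X *m X ^t*.
Let P := spectralmx S.
Let D := spectral_diag S.

Lemma spectral_mulmx_adj : S = P ^t* *m diag_mx D *m P.
Proof.
rewrite -invmx_unitary ?spectral_unitarymx //; apply/orthomx_spectralP.
by apply/normalmxP; rewrite /S !adjmxM !trmxCK.
Qed.

Lemma spectral_diag_mulmx_adj : diag_mx D = (P *m X) *m (P *m X) ^t*.
Proof.
have Pu : P *m P ^t* = 1%:M by apply/unitarymxP; exact: spectral_unitarymx.
rewrite adjmxM mulmxA -(mulmxA P) -/S spectral_mulmx_adj !mulmxA Pu mul1mx.
by rewrite -mulmxA Pu mulmx1.
Qed.

(** Each eigenvalue is the squared norm of a row of [P *m X]: this yields both its sign and the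
    vanishing of that row when it is zero. *)
Lemma spectral_diag_norm k : D 0 k = \sum_i `|(P *m X) k i| ^+ 2.
Proof.
move/matrixP/(_ k k): spectral_diag_mulmx_adj; rewrite mxE eqxx mulr1n => ->.
by rewrite mxE; apply: eq_bigr => i _; rewrite normCK !mxE.
Qed.

Lemma spectral_diag_ge0 k : 0 <= D 0 k.
Proof. by rewrite spectral_diag_norm sumr_ge0 // => i _; rewrite exprn_ge0. Qed.

Lemma spectral_diag_eq0 k i : D 0 k = 0 -> (P *m X) k i = 0.
Proof.
move/eqP; rewrite spectral_diag_norm psumr_eq0 => [/allP/(_ i)|j _].
  by rewrite mem_index_enum sqrf_eq0 normr_eq0 => /(_ isT)/eqP.
by rewrite exprn_ge0.
Qed.

(** If [u] is column [k] of [P ^t*], an eigenvector of [S], then [X ^t* u] is an eigenvector of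
    [X ^t* X] for the same eigenvalue. Its squared norm is that eigenvalue, so it is nonzero. *)
Lemma gram_eigenvector k : D 0 k != 0 ->
  exists2 x : 'cV[C]_n, x != 0 & X ^t* *m X *m x = D 0 k *: x.
Proof.
move=> Dk; exists (col k ((P *m X) ^t*)).
  apply: contraNneq Dk => xk0; rewrite spectral_diag_norm big1 // => i _.
  move/matrixP/(_ i 0): xk0; rewrite !mxE => /eqP; rewrite conjC_eq0 => /eqP.
  by move=> ->; rewrite normr0 expr0n.
have Pu : P *m P ^t* = 1%:M by apply/unitarymxP; exact: spectral_unitarymx.
have E : X ^t* *m X *m (P *m X) ^t* = (P *m X) ^t* *m diag_mx D.
  rewrite !adjmxM -!mulmxA; congr (_ *m _).
  by rewrite mulmxA -/S spectral_mulmx_adj -mulmxA Pu mulmx1.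
rewrite [in LHS]colE mulmxA E -colE.
by apply/colP => i; rewrite mul_mx_diag !mxE mulrC.
Qed.

(** This is [invsqrtmx S] with the inverse of the unitary [P] written as its adjoint. *)
Let Q := P ^t* *m diag_mx (map_mx (fun x => (sqrtC x)^-1) D) *m P.

Lemma invsqrt_adj : Q ^t* = Q.
Proof.
rewrite /Q !adjmxM trmxCK -mulmxA; congr (_ *m (_ *m _)).
rewrite tr_diag_mx map_diag_mx; congr diag_mx; apply/rowP => k; rewrite !mxE.
by apply: geC0_conj; rewrite invr_ge0 sqrtC_ge0 spectral_diag_ge0.
Qed.

(** In the eigenbasis the product is diagonal, with entry 1 at nonzero eigenvalues and, because
    [0^-1 = 0], entry 0 elsewhere: it projects onto the support of [S]. *)
Lemma invsqrt_support : projector (Q *m S *m Q).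
Proof.
have Pu : P *m P ^t* = 1%:M by apply/unitarymxP; exact: spectral_unitarymx.
pose E := diag_mx (map_mx (fun x => ((x != 0)%:R : C)) D).
have EE : E *m E = E.
  apply/matrixP => i j; rewrite mul_mx_diag !mxE.
  have [->/=|_] := eqVneq i j; last by rewrite !mulr0n mul0r.
  by case: (D 0 j != 0); rewrite !mulr1n ?mulr1 // mulr0n mulr0.
have -> : Q *m S *m Q = P ^t* *m E *m P.
  rewrite spectral_mulmx_adj /Q !mulmxA -(mulmxA _ P) Pu mulmx1.
  rewrite -(mulmxA _ P) Pu mulmx1 -(mulmxA (P ^t*)) -(mulmxA (P ^t*)).
  congr (_ *m _ *m _); apply/matrixP => i j; rewrite !mul_mx_diag !mxE.
  have [->|ij] := eqVneq i j; last by rewrite !mulr0n !mul0r.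
  rewrite !mulr1n mulrAC -invfM -expr2 sqrtCK.
  by have [->|nz] := eqVneq (D 0 j) 0; rewrite ?mulr0 // mulVf.
split.
  rewrite !adjmxM trmxCK -mulmxA; congr (_ *m (_ *m _)).
  rewrite tr_diag_mx map_diag_mx; congr diag_mx; apply/rowP => k; rewrite !mxE.
  by rewrite rmorph_nat.
by rewrite !mulmxA -(mulmxA _ P) Pu mulmx1 -(mulmxA (P ^t*)) EE.
Qed.

(** In the eigenbasis the form is an average of inverse square roots of eigenvalues, with weights
    [|w k|^2] of sum 1. The convention [0^-1 = 0] does not spoil the lower bound, since a column of
    [X] has zero weight on the kernel of [S]. *)
Lemma invsqrt_form_ge N i : (forall k, D 0 k <= N) ->
  ((col i X) ^t* *m col i X) 0 0 = 1 ->
  (sqrtC N)^-1 <= ((col i X) ^t* *m (Q *m col i X)) 0 0.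
Proof.
move=> DN x1; pose w := P *m col i X.
have Pu : P ^t* *m P = 1%:M.
  by apply: mulmx1C; apply/unitarymxP; exact: spectral_unitarymx.
have w1 : \sum_k `|w k 0| ^+ 2 = 1.
  by rewrite -x1 -adj_mul /w adjmxM -mulmxA (mulmxA (P ^t*)) Pu mul1mx.
have -> : ((col i X) ^t* *m (Q *m col i X)) 0 0 =
    \sum_k `|w k 0| ^+ 2 * (sqrtC (D 0 k))^-1.
  have -> : (col i X) ^t* *m (Q *m col i X) =
      w ^t* *m diag_mx (map_mx (fun x => (sqrtC x)^-1) D) *m w.
    by rewrite /w /Q adjmxM !mulmxA.
  by rewrite adj_mul_diag; apply: eq_bigr => k _; rewrite [map_mx _ _ 0 k]mxE.
have w0 k : D 0 k = 0 -> w k 0 = 0.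
  by move/spectral_diag_eq0 => /(_ i) <-; rewrite /w colE mulmxA -colE mxE.
rewrite -[X in X <= _]mul1r -w1 mulr_suml ler_sum // => k _.
have [D0|Dk] := eqVneq (D 0 k) 0; first by rewrite w0 // normr0 expr0n !mul0r.
have Dk0 : 0 < D 0 k by rewrite lt0r Dk spectral_diag_ge0.
apply: ler_wpM2l; first by rewrite exprn_ge0.
have N0 : 0 < N by exact: lt_le_trans (DN k).
by rewrite lef_pV2 ?posrE ?sqrtC_gt0 // ler_sqrtC ?DN // nnegrE ltW.
Qed.

End Spectral.

(** * Tensor products and powers, up to casts of dimensions *)

Section Tensor.
Variable K : comPzRingType.

(** Both sides multiply entries at the same three mixed-radix digits of each index; what remains are
    identities on quotients and remainders. *)
Lemma tensmxA m n p m' n' p' (A : 'M[K]_(m, m')) (B : 'M[K]_(n, n'))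
    (D : 'M[K]_(p, p')) :
  mxtens.tensmx (mxtens.tensmx A B) D =
  castmx (mulnA m n p, mulnA m' n' p') (mxtens.tensmx A (mxtens.tensmx B D)).
Proof.
apply/matrixP => i j; rewrite castmxE !mxE mulrA.
congr (A _ _ * B _ _ * D _ _); apply: val_inj => /=.
- by rewrite [(n * p)%N]mulnC divnMA.
- by rewrite [(n' * p')%N]mulnC divnMA.
- by rewrite modn_divl.
- by rewrite modn_divl.
- by rewrite modn_dvdm // dvdn_mull.
- by rewrite modn_dvdm // dvdn_mull.
Qed.

Lemma mxtrace_tens m n (A : 'M[K]_m) (B : 'M[K]_n) :
  \tr (mxtens.tensmx A B) = \tr A * \tr B.
Proof. by rewrite /mxtrace mxtens.mulr_sum; apply: eq_bigr => i _; rewrite mxE. Qed.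

Lemma mxtrace_cast n n' (e : n = n') (A : 'M[K]_n) :
  \tr (castmx (e, e) A) = \tr A.
Proof. by case: _ / e; rewrite castmx_id. Qed.

Lemma mulmx_castsq n n' (e : n = n') (A B : 'M[K]_n) :
  castmx (e, e) (A *m B) = castmx (e, e) A *m castmx (e, e) B.
Proof. by case: _ / e; rewrite !castmx_id. Qed.

Lemma cast_scalar_mx n n' (e : n = n') (a : K) :
  castmx (e, e) a%:M = a%:M.
Proof. by case: _ / e; rewrite castmx_id. Qed.

Lemma tens_castl m m' n (e : m = m') (f : (m * n = m' * n)%N)
    (A : 'M[K]_m) (B : 'M[K]_n) :
  mxtens.tensmx (castmx (e, e) A) B = castmx (f, f) (mxtens.tensmx A B).
Proof. by case: _ / e f => f; rewrite !castmx_id. Qed.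

Lemma tens_castr m m' n (e : m = m') (f : (n * m = n * m')%N)
    (A : 'M[K]_m) (B : 'M[K]_n) :
  mxtens.tensmx B (castmx (e, e) A) = castmx (f, f) (mxtens.tensmx B A).
Proof. by case: _ / e f => f; rewrite !castmx_id. Qed.

Lemma castsq_irr n n' (e f : n = n') (A : 'M[K]_n) :
  castmx (e, e) A = castmx (f, f) A.
Proof. by rewrite (eq_irrelevance e f). Qed.

(** The first power is [A] itself, without a factor of size 1, hence the separate case; the cast
    makes the recursion uniform in [k]. *)
Lemma ntensmxS n (A : 'M[K]_n) k :
  mxtens.ntensmx A k.+1 = castmx (esym (expnS n k), esym (expnS n k))
    (mxtens.tensmx A (mxtens.ntensmx A k)).
Proof.
case: k => [|k]; last by rewrite castmx_id.
rewrite mxtens.ntensmx0 mxtens.tens_mx_scalar scale1r castmx_comp.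
by rewrite castmx_id.
Qed.

Lemma ntensmxD n (A : 'M[K]_n) k l :
  mxtens.ntensmx A (k + l) = castmx (esym (expnD n k l), esym (expnD n k l))
    (mxtens.tensmx (mxtens.ntensmx A k) (mxtens.ntensmx A l)).
Proof.
elim: k => [|k IH].
  rewrite [mxtens.ntensmx A 0]mxtens.ntensmx0 mxtens.tens_scalar1mx.
  by rewrite castmx_comp castmx_id.
rewrite [in LHS]ntensmxS IH [in RHS]ntensmxS.
have f : (n * n ^ (k + l) = n * (n ^ k * n ^ l))%N by rewrite expnD.
have g : (n ^ k.+1 * n ^ l = n * n ^ k * n ^ l)%N by rewrite expnS.
rewrite (tens_castr _ (esym f)) (tens_castl _ (esym g)) tensmxA !castmx_comp.
exact: castsq_irr.
Qed.

Lemma tensmx1 m n : mxtens.tensmx (1%:M : 'M[K]_m) (1%:M : 'M[K]_n) = 1%:M.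
Proof.
apply/matrixP => i j; case: (mxtens.mxtens_indexP i) => a b.
case: (mxtens.mxtens_indexP j) => a' b'; rewrite mxtens.tensmxE !mxE.
rewrite (can_eq (@mxtens.mxtens_indexK _ _)) xpair_eqE.
by case: (a == a'); case: (b == b'); rewrite ?mulr1 ?mulr0.
Qed.

End Tensor.

(** * Euclidean norm and operator norm over the complex numbers *)

Section Complex.
Variable R : realType.
Local Notation C := (R[i]).

Lemma gramian_psdmx d (A : 'M[C]_d) : gramian A -> psdmx A.
Proof. by move=> gA v; exact: gramian_ge0. Qed.

Lemma Re_ge0K (z : C) : 0 <= z -> (complex.Re z)%:C = z.
Proof. by move=> z0; rewrite RRe_real // ger0_real. Qed.

Definition sqnorm d (v : 'cV[C]_d) : R :=
  \sum_k (complex.Re (v k 0) ^+ 2 + complex.Im (v k 0) ^+ 2).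

Lemma dotcE d (v : 'cV[C]_d) : dotc v v = (sqnorm v)%:C.
Proof.
rewrite /dotc [LHS]adj_mul /sqnorm rmorph_sum /=.
by apply: eq_bigr => k _; rewrite -add_Re2_Im2.
Qed.

Lemma sqnorm_ge0 d (v : 'cV[C]_d) : 0 <= sqnorm v.
Proof. by apply: sumr_ge0 => k _; rewrite addr_ge0 ?sqr_ge0. Qed.

Lemma l2normE d (v : 'cV[C]_d) : l2norm v = Num.sqrt (sqnorm v).
Proof. by rewrite /l2norm dotcE. Qed.

Lemma l2norm1 d (v : 'cV[C]_d) : l2norm v = 1 -> dotc v v = 1.
Proof.
rewrite l2normE dotcE => /(congr1 (fun x => x ^+ 2)).
by rewrite sqr_sqrtr ?sqnorm_ge0 // expr1n => ->.
Qed.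

Lemma normC_le_sqnorm d (v : 'cV[C]_d) k : `|v k 0| ^+ 2 <= (sqnorm v)%:C.
Proof.
rewrite -dotcE /dotc [X in _ <= X]adj_mul (bigD1 k) //= lerDl.
by apply: sumr_ge0 => i _; rewrite exprn_ge0.
Qed.

(** A crude bound, from coordinates of modulus at most 1. It serves to show that the set defining
    [opnorm] is bounded, so that its [sup] is a genuine upper bound. *)
Lemma l2norm_mul_ub m n (A : 'M[C]_(m, n)) (x : 'cV[C]_n) : l2norm x <= 1 ->
  (l2norm (A *m x))%:C ^+ 2 <= \sum_i (\sum_j `|A i j|) ^+ 2.
Proof.
rewrite l2normE => x1.
have {}x1 : sqnorm x <= 1.
  by rewrite -[X in _ <= X]sqrtr1 ler_sqrt // in x1.
rewrite l2normE -rmorphXn /= sqr_sqrtr ?sqnorm_ge0 // -dotcE /dotc.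
rewrite [X in X <= _]adj_mul; apply: ler_sum => i _.
apply: lerXn2r; rewrite ?nnegrE ?sumr_ge0 // mxE.
apply: le_trans (ler_norm_sum _ _ _) _; apply: ler_sum => j _.
rewrite normrM ler_piMr // -(@ler_pXn2r _ 2) ?nnegrE // expr1n.
by apply: le_trans (normC_le_sqnorm x j) _; rewrite lecR.
Qed.

Lemma opnorm_ub m n (A : 'M[C]_(m, n)) (x : 'cV[C]_n) :
  l2norm x <= 1 -> l2norm (A *m x) <= opnorm A.
Proof.
move=> x1; apply: ub_le_sup; last by exists x.
(* The [+ 1] avoids a square root: for [b >= 0], [a ^+ 2 <= b] implies [a <= b + 1], because the
   square of [a - 1] is nonnegative. *)
pose M := \sum_i (\sum_j `|A i j|) ^+ 2; exists (complex.Re M + 1) => _ [y /= y1 <-].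
have M0 : 0 <= M by apply: sumr_ge0 => i _; rewrite exprn_ge0 ?sumr_ge0.
have := l2norm_mul_ub A y1; rewrite -/M -[M]Re_ge0K // -rmorphXn lecR.
have : 0 <= complex.Re M by rewrite -lecR Re_ge0K.
move: (complex.Re M) (l2norm _) => b a b0 ab.
have := sqr_ge0 (a - 1); rewrite /= sqrrB; nra.
Qed.

Lemma opnorm_ge0 m n (A : 'M[C]_(m, n)) : 0 <= opnorm A.
Proof.
apply: (@le_trans _ _ (l2norm (A *m (0 : 'cV[C]_n)))).
  by rewrite l2normE sqrtr_ge0.
apply: opnorm_ub; rewrite l2normE /sqnorm big1 ?sqrtr0 // => k _.
by rewrite mxE /= expr0n addr0.
Qed.

Lemma opnorm_eigen n (A : 'M[C]_n) (x : 'cV[C]_n) (a : R) :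
  0 <= a -> x != 0 -> A *m x = a%:C *: x -> a <= opnorm A.
Proof.
move=> a0 x0 Ax.
have sqZ (t : R) (v : 'cV[C]_n) : sqnorm (t%:C *: v) = t ^+ 2 * sqnorm v.
  rewrite /sqnorm mulr_sumr; apply: eq_bigr => k _; rewrite mxE.
  by case: (v k 0) => b c /=; ring.
have sx : 0 < sqnorm x.
  rewrite lt0r sqnorm_ge0 andbT; apply: contraNneq x0 => s0.
  apply/eqP/colP => k; rewrite mxE; apply/eqP; rewrite -normr_eq0 -sqrf_eq0.
  by rewrite eq_le exprn_ge0 // andbT (le_trans (normC_le_sqnorm x k)) // s0.
pose y := (Num.sqrt (sqnorm x))^-1%:C *: x.
have y1 : sqnorm y = 1.
  by rewrite sqZ exprVn sqr_sqrtr ?ltW // mulVf // gt_eqF.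
have := @opnorm_ub _ _ A y; rewrite !l2normE y1 sqrtr1 => /(_ (lexx _)).
rewrite /y -scalemxAr Ax scalerA mulrC -scalerA -/y sqZ y1 mulr1.
by rewrite sqrtr_sqr ger0_norm.
Qed.

(** The image of the first basis vector is the first column of the Gram matrix, whose diagonal entry
    is 1. *)
Lemma opnorm_gram_ge1 d n (psi : 'I_n.+1 -> 'cV[C]_d) :
  (forall i, l2norm (psi i) = 1) -> 1 <= opnorm (gram psi).
Proof.
move=> psi1; pose e : 'cV[C]_n.+1 := delta_mx 0 0.
have e1 : l2norm e <= 1.
  rewrite l2normE /sqnorm (bigD1 ord0) //= big1 ?addr0 => [|i i0].
    by rewrite mxE eqxx /= expr0n addr0 expr1n sqrtr1.
  by rewrite mxE (negbTE i0) /= expr0n addr0.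
apply: le_trans (opnorm_ub _ e1); rewrite l2normE -[X in X <= _]sqrtr1 ler_wsqrtr //.
have := normC_le_sqnorm (gram psi *m e) 0.
by rewrite /e -colE !mxE l2norm1 // normr1 expr1n -[1]/(1%:C) lecR.
Qed.

End Complex.

(** * The pretty good measurement on one copy *)

Section PGM.
Variable R : realType.
Local Notation C := (R[i]).
Variables (d n : nat) (psi : 'I_n -> 'cV[C]_d).
Hypothesis psi1 : forall i, l2norm (psi i) = 1.
Let rho i := proj1 (psi i).
Let N := opnorm (gram psi).
Let X : 'M[C]_(d, n) := \matrix_(a, i) psi i a 0.
Let Q := invsqrtmx (\sum_j rho j).

Lemma col_statesE i : col i X = psi i.
Proof. by apply/colP => a; rewrite !mxE. Qed.

Lemma sum_statesE : \sum_j rho j = X *m X ^t*.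
Proof.
apply/matrixP => a b; rewrite summxE mxE; apply: eq_bigr => i _.
by rewrite /rho /proj1 mxE big_ord_recl big_ord0 addr0 !mxE.
Qed.

Lemma gram_statesE : gram psi = X ^t* *m X.
Proof.
apply/matrixP => i j; rewrite [LHS]mxE /dotc [LHS]mxE [RHS]mxE.
by apply: eq_bigr => k _; rewrite !mxE.
Qed.

Lemma invsqrt_statesE : Q = (spectralmx (X *m X ^t*)) ^t* *m
  diag_mx (map_mx (fun x => (sqrtC x)^-1) (spectral_diag (X *m X ^t*))) *m
  spectralmx (X *m X ^t*).
Proof.
by rewrite /Q sum_statesE /invsqrtmx invmx_unitary // spectral_unitarymx.
Qed.

Lemma invsqrt_states_adj : Q ^t* = Q.
Proof. by rewrite invsqrt_statesE; exact: invsqrt_adj. Qed.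

Lemma gramian_pgm i : gramian (pgm rho i).
Proof.
exists 1%N, ((Q *m psi i) ^t*).
by rewrite trmxCK adjmxM invsqrt_states_adj /pgm -/Q /rho /proj1 !mulmxA.
Qed.

Lemma sum_pgmE : \sum_i pgm rho i = Q *m (\sum_i rho i) *m Q.
Proof. by rewrite mulmx_sumr mulmx_suml. Qed.

Lemma projector_sum_pgm : projector (\sum_i pgm rho i).
Proof. by rewrite sum_pgmE invsqrt_statesE sum_statesE; exact: invsqrt_support. Qed.

(** The complementary outcome [None] is semidefinite because the other operators sum to a
    projector. *)
Lemma is_POVM_pgm : is_POVM (complete_meas (pgm rho)).
Proof.
split=> [[i|]|] /=; last 1 first.
- rewrite (bigD1 None) //= (reindex_omap Some id) => [|[]] //=.
  by rewrite [X in _ + X](eq_bigl predT) ?subrK // => i; rewrite eqxx.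
- exact/gramian_psdmx/gramian_pgm.
- exact/gramian_psdmx/projector_gramian/projectorC/projector_sum_pgm.
Qed.

Lemma spectral_states_le k : spectral_diag (X *m X ^t*) 0 k <= N%:C.
Proof.
have [->|nz] := eqVneq (spectral_diag (X *m X ^t*) 0 k) 0.
  by rewrite ler0c; exact: opnorm_ge0.
have D0 := spectral_diag_ge0 X k; have [x x0 Gx] := gram_eigenvector nz.
rewrite -[X in X <= _]Re_ge0K // lecR; apply: (opnorm_eigen _ x0).
  by rewrite -lecR Re_ge0K.
by rewrite gram_statesE Re_ge0K.
Qed.

Lemma pgm_success i : 0 < N -> N^-1%:C <= \tr (pgm rho i *m rho i).
Proof.
move=> N0; pose q := ((psi i) ^t* *m (Q *m psi i)) 0 0.
have -> : \tr (pgm rho i *m rho i) = q ^+ 2.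
  rewrite /rho [LHS]mxtrace_mul_proj1 /pgm -/Q /rho /proj1.
  have -> : (psi i) ^t* *m (Q *m (psi i *m (psi i) ^t*) *m Q *m psi i) =
     ((psi i) ^t* *m (Q *m psi i)) *m ((psi i) ^t* *m (Q *m psi i)).
    by rewrite !mulmxA.
  by rewrite mxE big_ord_recl big_ord0 addr0 expr2.
have : (sqrtC N%:C)^-1 <= q.
  rewrite /q -col_statesE invsqrt_statesE; apply: invsqrt_form_ge.
    exact: spectral_states_le.
  by rewrite col_statesE; exact: (l2norm1 (psi1 i)).
have s0 : 0 <= (sqrtC N%:C)^-1 by rewrite invr_ge0 sqrtC_ge0 ler0c ltW.
move=> sq; have q0 := le_trans s0 sq.
rewrite fmorphV /= -[N%:C]sqrtCK -exprVn.
by apply: lerXn2r; rewrite ?nnegrE.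
Qed.

End PGM.

(** Since [q <= 1], each round adds at most [b] to the error already present; since [q <= c], the
    initial value is damped by [c] at each round. *)
Lemma recursion_le (K : numDomainType) (f : nat -> K) (w q b c : K) :
  0 <= q <= 1 -> q <= c -> w <= b -> 0 <= b ->
  f 0%N <= 1 -> (forall r, f r.+1 = w + q * f r) ->
  forall r, f r <= r%:R * b + c ^+ r.
Proof.
move=> /andP[q0 q1] qc wb b0 f0 fS; elim=> [|r IH]; first by rewrite mul0r add0r.
rewrite fS mulrSr mulrDl mul1r addrAC [X in _ <= X]addrC; apply: lerD => //.
apply: le_trans (ler_wpM2l q0 IH) _; rewrite mulrDr; apply: lerD.
  by apply: ler_piMl => //; apply: mulr_ge0.
by rewrite exprS; apply: ler_wpM2r => //; apply: exprn_ge0; exact: le_trans qc.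
Qed.

(** * The repeated rounds: validity of the measurement and failure bound *)

Section Rounds.
Variable R : realType.
Local Notation C := (R[i]).

Lemma gramian_tensc d k l (A : 'M[C]_(d ^ k)) (B : 'M[C]_(d ^ l)) :
  gramian A -> gramian B -> gramian (tensc A B).
Proof. by move=> gA gB; apply: gramian_cast; exact: gramian_tens. Qed.

Lemma tensc_sumr d k l (I : finType) (A : 'M[C]_(d ^ k))
    (B : I -> 'M[C]_(d ^ l)) : tensc A (\sum_i B i) = \sum_i tensc A (B i).
Proof.
apply/matrixP => a b; rewrite summxE castmxE mxE summxE mulr_sumr.
by apply: eq_bigr => i _; rewrite castmxE mxE.
Qed.

Lemma tensc_suml d k l (I : finType) (A : I -> 'M[C]_(d ^ k))
    (B : 'M[C]_(d ^ l)) : tensc (\sum_i A i) B = \sum_i tensc (A i) B.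
Proof.
apply/matrixP => a b; rewrite summxE castmxE mxE summxE mulr_suml.
by apply: eq_bigr => i _; rewrite castmxE mxE.
Qed.

Lemma tenscBl d k l (A A' : 'M[C]_(d ^ k)) (B : 'M[C]_(d ^ l)) :
  tensc (A - A') B = tensc A B - tensc A' B.
Proof. by apply/matrixP => a b; rewrite !(castmxE, mxE) mulrBl. Qed.

Lemma tenscBr d k l (A : 'M[C]_(d ^ k)) (B B' : 'M[C]_(d ^ l)) :
  tensc A (B - B') = tensc A B - tensc A B'.
Proof. by apply/matrixP => a b; rewrite !(castmxE, mxE) mulrBr. Qed.

Lemma tensc1 d k l : tensc (1%:M : 'M[C]_(d ^ k)) (1%:M : 'M[C]_(d ^ l)) = 1%:M.
Proof. by rewrite /tensc tensmx1 cast_scalar_mx. Qed.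

Lemma mxtrace_tensc_tpow d k l (A : 'M[C]_(d ^ k)) (B : 'M[C]_(d ^ l))
    (M : 'M[C]_d) :
  \tr (tensc A B *m tpow M (k + l)) = \tr (A *m tpow M k) * \tr (B *m tpow M l).
Proof.
by rewrite /tpow ntensmxD /tensc -mulmx_castsq mxtrace_cast
  mxtens.tensmx_mul mxtrace_tens.
Qed.

Lemma mxtrace_mul_tpow d k (A B : 'M[C]_d) :
  \tr (tpow A k *m tpow B k) = \tr (A *m B) ^+ k.
Proof.
elim: k => [|k IH]; first by rewrite mulmx1 mxtrace1 expr0.
by rewrite /tpow !ntensmxS -mulmx_castsq mxtrace_cast mxtens.tensmx_mul
  mxtrace_tens IH exprS.
Qed.

Lemma mxtrace_tpow d k (A : 'M[C]_d) : \tr (tpow A k) = \tr A ^+ k.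
Proof.
elim: k => [|k IH]; first by rewrite mxtrace1 expr0.
by rewrite /tpow !ntensmxS mxtrace_cast mxtrace_tens IH exprS.
Qed.

Variables (d n : nat) (psi : 'I_n.+1 -> 'cV[C]_d).
Hypothesis psi1 : forall i, l2norm (psi i) = 1.
Let rho i := proj1 (psi i).
Let N := opnorm (gram psi).
Variable m : nat.

Lemma projector_state i : projector (rho i).
Proof. by apply: projector_proj1; exact: (l2norm1 (psi1 i)). Qed.

Lemma gramian_accept i : gramian (accept rho m i).
Proof.
apply: (@gramian_tensc d 1 m); first exact: gramian_pgm.
exact/projector_gramian/projector_ntens/projector_state.
Qed.

Lemma gramian_reject : gramian (1%:M - \sum_j accept rho m j).
Proof.
(* 1 - sum_j P_j (x) T_j = (1 - sum_j P_j) (x) 1 + sum_j P_j (x) (1 - T_j) *)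
pose F j := @tensc R d 1 m (pgm rho j) (1%:M - tpow (rho j) m).
have -> : 1%:M - \sum_j accept rho m j =
    @tensc R d 1 m (1%:M - \sum_j pgm rho j) 1%:M + \sum_j F j.
  have -> : \sum_j F j = @tensc R d 1 m (\sum_j pgm rho j) 1%:M
      - \sum_j accept rho m j.
    rewrite tensc_suml -sumrB; apply: eq_bigr => j _.
    by rewrite /F tenscBr.
  by rewrite (@tenscBl d 1 m) (@tensc1 d 1 m) addrA subrK.
apply: gramianD.
  apply: (@gramian_tensc d 1 m); last exact: gramian1.
  exact/projector_gramian/projectorC/projector_sum_pgm.
apply: gramian_sum => j; apply: (@gramian_tensc d 1 m); first exact: gramian_pgm.
exact/projector_gramian/projectorC/projector_ntens/projector_state.
Qed.

Lemma gramian_repeat_rounds r i : gramian (repeat_rounds rho m r i).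
Proof.
elim: r => [|r IH] /=.
  by case: (i == ord0); [exact: gramian1|rewrite raddf0; exact: gramian0].
apply: gramianD; apply: (@gramian_tensc d (1 + m) (r * (1 + m))) => //;
  [|exact: gramian1|].
  exact: gramian_accept.
exact: gramian_reject.
Qed.

(** Accepting and rejecting effects split the identity on the first block, and by induction the
    remaining rounds sum to the identity on theirs. *)
Lemma is_POVM_repeat_rounds r : is_POVM (repeat_rounds rho m r).
Proof.
split=> [i|]; first exact/gramian_psdmx/gramian_repeat_rounds.
elim: r => [|r IH] /=.
  rewrite (bigD1 ord0) //= big1 ?addr0 // => i /negbTE ->.
  by rewrite raddf0.
pose k := (1 + m)%N; pose l := (r * (1 + m))%N.
rewrite big_split /= -(@tensc_suml d k l) -(@tensc_sumr d k l) IH.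
by rewrite (@tenscBl d k l) addrC subrK (@tensc1 d k l).
Qed.

Variable i : 'I_n.+1.
(** On input [rho i], [a j] is the probability that one round accepts [j], and [s r] the probability
    that [r] rounds output [i]. *)
Let a j := \tr (accept rho m j *m tpow (rho i) (1 + m)).
Let s r := \tr (repeat_rounds rho m r i *m tpow (rho i) (r * (1 + m))).

Lemma mxtrace_state : \tr (rho i) = 1.
Proof.
have [_ ri] := projector_state i.
by rewrite /rho /proj1 mxtrace_mulC -[RHS](l2norm1 (psi1 i)) [LHS]trace_mx11.
Qed.

Lemma mxtrace_state_tpow k : \tr (tpow (rho i) k) = 1.
Proof. by rewrite mxtrace_tpow mxtrace_state expr1n. Qed.

Lemma acceptE j :
  a j = \tr (pgm rho j *m rho i) * \tr (rho j *m rho i) ^+ m.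
Proof. by rewrite /a /accept (@mxtrace_tensc_tpow d 1 m) mxtrace_mul_tpow. Qed.

(** Either the first round accepts [i], or it accepts nothing and the later rounds output [i]; the
    trace factorizes because each round uses fresh copies. *)
Lemma repeat_roundsS r : s r.+1 = a i + (1 - \sum_j a j) * s r.
Proof.
rewrite /s /= mulmxDl raddfD /= !(@mxtrace_tensc_tpow d (1 + m)).
rewrite mul1mx mxtrace_state_tpow mulr1; congr (_ + _ * _).
rewrite mulmxBl mul1mx raddfB /= mxtrace_state_tpow mulmx_suml.
by rewrite [\tr (\sum_j _)]raddf_sum.
Qed.

Lemma repeat_rounds_failure b r : 0 <= b ->
  (forall j, j != i -> complex.Re (\tr (rho j *m rho i)) <= b) ->
  1 - complex.Re (s r) <= r%:R * b ^+ m + (1 - N^-1) ^+ r.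
Proof.
move=> b0 sep.
have N0 : 0 < N by apply: lt_le_trans (opnorm_gram_ge1 psi1); exact: ltr01.
have N1 : N^-1 <= 1 by rewrite invf_le1 // opnorm_gram_ge1.
have rho_ge0 j : gramian (rho j) by exact/projector_gramian/projector_state.
have t_ge0 j : 0 <= \tr (rho j *m rho i) by exact: gramian_mxtrace_ge0.
have p_ge0 j : 0 <= \tr (pgm rho j *m rho i).
  by apply: gramian_mxtrace_ge0 => //; exact: gramian_pgm.
have p_sum : \sum_j \tr (pgm rho j *m rho i) <= 1.
  rewrite -subr_ge0 -raddf_sum -mulmx_suml -mxtrace_state -raddfB /=.
  rewrite -[X in X - _]mul1mx -mulmxBl; apply: gramian_mxtrace_ge0 => //.
  exact/projector_gramian/projectorC/projector_sum_pgm.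
have t_le1 j : j != i -> \tr (rho j *m rho i) <= b%:C.
  by move=> ji; rewrite -[X in X <= _]Re_ge0K // lecR; exact: sep.
have aii : \tr (rho i *m rho i) = 1.
  by have [_ ->] := projector_state i; exact: mxtrace_state.
have a_ge0 j : 0 <= a j by rewrite acceptE mulr_ge0 // exprn_ge0.
have ai : N^-1%:C <= a i.
  by rewrite acceptE aii expr1n mulr1; exact: pgm_success.
have a_sum : \sum_j a j = a i + \sum_(j | j != i) a j by rewrite (bigD1 i).
have w0 : 0 <= \sum_(j | j != i) a j by apply: sumr_ge0 => j _; exact: a_ge0.
(* The checks scale each wrong outcome by at most [b ^+ m], and the wrong outcomes of the pretty
   good measurement have total probability at most 1. *)
have wb : \sum_(j | j != i) a j <= b%:C ^+ m.
  apply: (@le_trans _ _ (\sum_(j | j != i) \tr (pgm rho j *m rho i) * b%:C ^+ m)).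
    apply: ler_sum => j ji; rewrite acceptE ler_wpM2l //.
    by apply: lerXn2r; rewrite ?nnegrE ?ler0c ?t_le1.
  rewrite -mulr_suml ler_piMl ?exprn_ge0 ?ler0c //.
  apply: le_trans p_sum; rewrite [X in _ <= X](bigD1 i) //= lerDr.
  exact: p_ge0.
have a_le1 : \sum_j a j <= 1.
  apply: le_trans p_sum; apply: ler_sum => j _; rewrite acceptE ler_piMr //.
  apply: exprn_ile1 => //.
  have [->|ji] := eqVneq j i; first by rewrite aii.
  rewrite -subr_ge0 -[X in X - _]mxtrace_state -raddfB /=.
  rewrite -[X in X - _]mul1mx -mulmxBl; apply: gramian_mxtrace_ge0 => //.
  exact/projector_gramian/projectorC/projector_state.
(* The recursion is run over the complex numbers, where the traces live: [w] is the probability of a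
   wrong acceptance and [q] that of no acceptance. Real parts are taken only afterwards. *)
have : 1 - s r <= r%:R * b%:C ^+ m + (1 - N^-1%:C) ^+ r.
  apply: (@recursion_le C (fun r => 1 - s r) (\sum_(j | j != i) a j)
    (1 - \sum_j a j)) => [||||| k] //.
  - by rewrite subr_ge0 a_le1 lerBlDr lerDl a_sum addr_ge0.
  - by rewrite lerD2l lerN2 a_sum (le_trans ai) // lerDl.
  - by rewrite exprn_ge0 // ler0c.
  - rewrite lerBlDr lerDl; apply: gramian_mxtrace_ge0.
      exact: gramian_repeat_rounds.
    exact/projector_gramian/projector_ntens/projector_state.
  - by rewrite repeat_roundsS a_sum; ring.
have -> : r%:R * b%:C ^+ m + (1 - N^-1%:C) ^+ r =
    (r%:R * b ^+ m + (1 - N^-1) ^+ r)%:C :> C.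
  by rewrite rmorphD rmorphM !rmorphXn rmorphB rmorph1 rmorph_nat.
by rewrite lecE => /andP[_]; case: (s r).
Qed.

Lemma repeat_rounds0 : i = ord0 -> s 0%N = 1.
Proof. by move=> i0; rewrite /s /= i0 eqxx mulmx1 mxtrace1. Qed.

End Rounds.

(** * Choice of the parameters and growth of the number of copies *)

Section Copies.
Variable R : realType.
Implicit Types N eps delta x y : R.

Lemma lnM_gt0 x y : 0 < x -> 0 < y -> ln (x * y) = ln x + ln y.
Proof. by move=> x0 y0; rewrite lnM ?posrE. Qed.

Lemma ln_div1 x : 0 < x -> ln (1 / x) = - ln x.
Proof. by move=> x0; rewrite div1r lnV ?posrE. Qed.

(** This follows from [1 - c <= expR (- c)]. *)
Lemma subr_expR_le (c y : R) r : 0 <= 1 - c -> 0 < y -> - ln y <= r%:R * c ->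
  (1 - c) ^+ r <= y.
Proof.
move=> c1 y0 H.
apply: (@le_trans _ _ (expR (- c) ^+ r)).
  by apply: lerXn2r; rewrite ?nnegrE ?expR_ge0 // expR_ge1Dx.
rewrite -expRM_natl -[X in _ <= X]lnK ?posrE // ler_expR; lra.
Qed.

(** The successor of a truncation exceeds the truncated real, so [rounds] and [checks] are large
    enough for [subr_expR_le]: the checks bring the error of each of the [r] rounds down to
    [delta / (2 * r)]. *)
Lemma rounds_checks_error N eps delta : 1 <= N -> 0 < eps <= 1 -> 0 < delta < 1 ->
  (rounds N eps delta)%:R * (1 - eps) ^+ checks N eps delta
    + (1 - N^-1) ^+ rounds N eps delta <= delta.
Proof.
move=> N1 /andP[e0 e1] /andP[d0 d1].
have N0 : 0 < N by lra.
have Ni : N^-1 <= 1 by rewrite invf_le1.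
rewrite /checks; set r := rounds N eps delta.
have rE : r = (Num.truncn (N * ln (2 / delta))).+1 by rewrite /r /rounds ltNge e1.
have r0 : (0 < r%:R :> R) by rewrite rE ltr0n.
set m := (Num.truncn _).+1.
have h1 : (1 - N^-1) ^+ r <= delta / 2.
  apply: subr_expR_le; [by rewrite subr_ge0|by lra|].
  have -> : - ln (delta / 2) = ln (2 / delta).
    by rewrite -lnV ?posrE ?invf_div //; lra.
  by rewrite ler_pdivlMr // mulrC rE ltW // truncnS_gt.
have h2 : (1 - eps) ^+ m <= delta / (2 * r%:R).
  have q0 : 0 < delta / (2 * r%:R) by rewrite divr_gt0 ?mulr_gt0.
  apply: subr_expR_le; [by rewrite subr_ge0|by []|].
  rewrite -lnV ?posrE // invf_div -ler_pdivrMr // ltW //.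
  exact: truncnS_gt.
have h3 : r%:R * (1 - eps) ^+ m <= delta / 2.
  by rewrite mulrC -ler_pdivlMr // -mulrA -invfM.
by rewrite [leRHS]splitr lerD.
Qed.

Lemma copies_bigO : bigO3 (fun N eps delta : R => (copies N eps delta)%:R)
  (fun N eps delta : R => (N / eps) * ln (1 / delta) * ln (N / delta)).
Proof.
move=> delta0 /andP[D0 D1]; pose L := - ln delta0.
have L0 : 0 < L by rewrite oppr_gt0 ln_lt0 // D0 D1.
have l2 : 0 < ln 2 :> R by rewrite ln_gt0 // ltr1n.
(* The bound [ln (1 / delta) >= L > 0] lets the constants absorb additive terms. *)
pose K1 := 1 + (1 + ln 2) / L.
pose K2 := (2 + ln 2 + ln K1) / L + 2.
have K11 : 1 <= K1 by rewrite lerDl divr_ge0 // ltW //; lra.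
have lK1 : 0 <= ln K1 by rewrite ln_ge0.
have K20 : 0 < K2 by rewrite ltr_wpDl // divr_ge0 // ?ltW //; lra.
exists (K1 * K2); first by rewrite mulr_gt0 //; lra.
move=> N eps delta N1 e0 /andP[d0 dD].
have N0 : 0 < N by lra.
rewrite ln_div1 // [ln (N / _)]lnM_gt0 ?invr_gt0 // lnV ?posrE //.
set u := - ln delta; set v := ln N.
have v0 : 0 <= v by rewrite ln_ge0.
have uL : L <= u by rewrite lerN2 ler_ln ?posrE.
have u0 : 0 < u by lra.
have g0 : 0 <= N / eps * u * (v + u).
  by rewrite !mulr_ge0 ?invr_ge0 ?addr_ge0 // ltW.
rewrite ger0_norm // ger0_norm //.
have [e1|e1] := ltP 1 eps.
  rewrite /copies /rounds e1 mul0n; apply: mulr_ge0 => //.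
  by apply: mulr_ge0; lra.
rewrite /copies natrM natrD /checks; set r := rounds N eps delta.
have rE : r = (Num.truncn (N * ln (2 / delta))).+1 by rewrite /r /rounds ltNge e1.
have lE : ln (2 / delta) = ln 2 + u by rewrite lnM_gt0 ?invr_gt0 // lnV.
have r1 : (1 <= r%:R :> R) by rewrite rE ler1n.
(* As [1 <= N], the lower-order terms [N * ln 2 + 1] are at most [(1 + ln 2) * N], which
   [1 <= u / L] turns into a multiple of [N * u]. *)
have rle : r%:R <= K1 * (N * u).
  have : r%:R <= N * (ln 2 + u) + 1.
    rewrite rE -lE -natr1 lerD2r truncn_le mulr_ge0 ?ltW // lE; lra.
  move/le_trans; apply.
  have Lu : 1 <= u / L by rewrite ler_pdivlMr // mul1r.
  have -> : K1 * (N * u) = N * u + (1 + ln 2) * N * (u / L).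
    by rewrite /K1; field; exact: lt0r_neq0.
  have : (1 + ln 2) * N <= (1 + ln 2) * N * (u / L).
    by rewrite ler_peMr // mulr_ge0; lra.
  nra.
have lr : ln (2 * r%:R / delta) <= ln 2 + ln K1 + (v + u) + u.
  rewrite lnM_gt0 ?invr_gt0 ?mulr_gt0 //; last by lra.
  rewrite lnV // lnM_gt0 //; last by lra.
  have : ln r%:R <= ln K1 + (v + ln u).
    rewrite -lnM_gt0 // -lnM_gt0 ?mulr_gt0 //; last by lra.
    by rewrite ler_ln ?posrE ?mulr_gt0 //; lra.
  (* This absorbs the iterated logarithm of [1 / delta] that [ln r] contributes. *)
  have : ln u <= u by have := @ln_sublinear R u u0; lra.
  rewrite -/u; lra.
have lr0 : 0 <= ln (2 * r%:R / delta).
  rewrite ln_ge0 // ler_pdivlMr // mul1r; lra.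
set l := ln _ in lr lr0 *.
(* The tested copy and the successor in [checks] cost 2, which is at most [2 / eps] since
   [eps <= 1]. *)
have cle : 1 + ((Num.truncn (l / eps)).+1)%:R <= K2 * ((v + u) / eps).
  have : (Num.truncn (l / eps))%:R <= l / eps by rewrite truncn_le divr_ge0 // ltW.
  rewrite -natr1 => h.
  have -> : K2 * ((v + u) / eps) = ((2 + ln 2 + ln K1) * ((v + u) / L) + 2 * (v + u)) / eps.
    rewrite /K2; field; rewrite !lt0r_neq0 //.
  have Lu : 1 <= (v + u) / L by rewrite ler_pdivlMr // mul1r; lra.
  have : 2 + ln 2 + ln K1 <= (2 + ln 2 + ln K1) * ((v + u) / L).
    by rewrite ler_peMr //; lra.
  have h2 : 2 <= 2 / eps by rewrite ler_pdivlMr // ; lra.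
  move=> h3; apply: (@le_trans _ _ (2 / eps + l / eps)); first lra.
  by rewrite -mulrDl ler_wpM2r ?invr_ge0 ?(ltW e0) //; lra.
apply: (@le_trans _ _ (K1 * (N * u) * (K2 * ((v + u) / eps)))).
  by apply: ler_pM => //; rewrite addr_ge0.
by rewrite le_eqVlt; apply/orP; left; apply/eqP; ring.
Qed.

(** Each of the two logarithms in [copies_bigO] is at most the sum of absolute logarithms, hence
    exponent 2. *)
Lemma copies_softO : softO3 (fun N eps delta : R => (copies N eps delta)%:R)
  (fun N eps delta : R => N / eps).
Proof.
exists 2%N => delta0 hD; have [K K0 HK] := copies_bigO hD.
exists K => // N eps delta N1 e0 hd; apply: le_trans (HK _ _ _ N1 e0 hd) _.
have /andP[d0 _] := hd; have N0 : 0 < N by lra.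
rewrite ler_pM2l // -mulrA normrM [leRHS]normrM ler_wpM2l //.
rewrite ln_div1 // lnM_gt0 ?invr_gt0 // lnV ?posrE //.
rewrite [leRHS]ger0_norm ?exprn_ge0 ?addr_ge0 // normrM normrN expr2.
apply: ler_pM => //; first by rewrite lerDr !addr_ge0.
apply: le_trans (ler_normB _ _) _.
have := normr_ge0 (ln eps^-1); lra.
Qed.

End Copies.

Theorem theorem2 (R : realType) :
  (forall (d n : nat) (psi : 'I_n.+1 -> 'cV[R[i]%C]_d),
     pure_state_set psi ->
     let rho := fun i => proj1 (psi i) in
     is_POVM (complete_meas (pgm rho)) /\
     (opnorm (gram psi))^-1 <= @success_prob R d n.+1 1 (pgm rho) rho)
  /\
  [/\ bigO3 (fun N eps delta : R => (copies N eps delta)%:R)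
        (fun N eps delta : R =>
           (N / eps) * ln (1 / delta) * ln (N / delta)),
      softO3 (fun N eps delta : R => (copies N eps delta)%:R)
        (fun N eps delta : R => N / eps)
    & forall (d n : nat) (psi : 'I_n.+1 -> 'cV[R[i]%C]_d) (eps delta : R),
        pure_state_set psi -> 0 < eps -> 0 < delta ->
        let rho := fun i => proj1 (psi i) in
        (forall i j, rho i <> rho j ->
           complex.Re (\tr (rho i *m rho j)) <= 1 - eps) ->
        is_POVM (strategy psi eps delta) /\
        failure_prob (strategy psi eps delta) rho <= delta].
Proof.
split=> [d n psi [psi1 _] rho|].
  have N1 := opnorm_gram_ge1 psi1.
  have N0 : 0 < opnorm (gram psi) by lra.
  have Ni : (opnorm (gram psi))^-1 <= 1 by rewrite invf_le1.
  split; first exact: is_POVM_pgm.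
  rewrite /success_prob lerBrDr addrC -lerBrDr /failure_prob.
  (* The default 0 of the maximum must be bounded too, which is where [Ni] enters. *)
  apply/bigmax_leP; split=> [|i _]; first by rewrite subr_ge0.
  have := pgm_success psi1 i N0.
  rewrite lerD2l lerN2 lecE => /andP[_]; exact.
split; [exact: copies_bigO|exact: copies_softO|].
move=> d n psi eps delta [psi1 psiI] e0 d0 rho sep.
have POVM : is_POVM (strategy psi eps delta) by exact: is_POVM_repeat_rounds.
split=> //; apply/bigmax_leP; split=> [|i _]; first exact: ltW.
have N1 := opnorm_gram_ge1 psi1.
set m := checks (opnorm (gram psi)) eps delta.
set r := rounds (opnorm (gram psi)) eps delta.
(* For [delta >= 1] nonnegativity of the success probability suffices; [rounds_checks_error] covers
   only [delta < 1]. *)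
have [d1|d1] := leP 1 delta.
  apply: le_trans d1; rewrite lerBlDr lerDl.
  have : 0 <= \tr (repeat_rounds rho m r i *m tpow (rho i) (r * (1 + m))).
    apply: gramian_mxtrace_ge0; first exact: gramian_repeat_rounds.
    exact/projector_gramian/projector_ntens/projector_state.
  by rewrite lecE => /andP[_].
(* Separation is assumed for distinct states; injectivity of the enumeration transfers it to
   distinct indices. *)
have sep' j : j != i -> complex.Re (\tr (rho j *m rho i)) <= 1 - eps.
  by move=> ji; apply: sep => /psiI ij; rewrite ij eqxx in ji.
have t_ge0 j : 0 <= complex.Re (\tr (rho j *m rho i)).
  have : 0 <= \tr (rho j *m rho i).
    by apply: gramian_mxtrace_ge0; apply/projector_gramian/projector_state.
  by rewrite lecE => /andP[_].
have [e1|e1] := leP eps 1.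
  have e01 : 0 < eps <= 1 by apply/andP.
  have d01 : 0 < delta < 1 by apply/andP.
  apply: le_trans (rounds_checks_error N1 e01 d01).
  by apply: repeat_rounds_failure; rewrite ?subr_ge0.
(* [eps > 1] contradicts [sep] unless there is a single state; no round is
   run then. *)
have single j : j = i.
  by apply/eqP/contraT => ji; have := sep' j ji; have := t_ge0 j; lra.
have r0 : r = 0%N by rewrite /r /rounds e1.
(* The matrix dimension depends on the number of rounds, so the value 0 is substituted for a
   variable [k] instead of being rewritten in place. *)
have zero_rounds k : k = 0%N -> complex.Re
    (\tr (repeat_rounds rho m k i *m tpow (rho i) (k * (1 + m)))) = 1.
  by move=> ->; rewrite (repeat_rounds0 psi m (esym (single ord0))).
apply: le_trans (ltW d0); rewrite subr_le0 (_ : complex.Re _ = 1) //.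
exact: (zero_rounds r r0).
Qed.
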